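(* Let $\mathfrak{L}$ be a linearly ordered idempotent semifield with $\mathfrak{L}\neq\mathbb{B}$. For every $n\geq 5$ there is an idempotent $E\in UT_n(\mathfrak{L}^* )$ such that the $\widetilde{\mathcal{H}}$-class $\widetilde{H}_E$ of $E$ in $UT_n(\mathfrak{L}^* )$ is not a subsemigroup of $UT_n(\mathfrak{L}^* )$.
   Context: A linearly ordered idempotent semifield is a commutative semiring $\mathfrak{L}$ with $x+x=x$ for all $x$, in which $\mathfrak{L}^*=\mathfrak{L}\setminus\{\mathbf{0}\}$ is an abelian group under multiplication, and in which the order $a\leq b\iff a+b=b$ is total (so addition is maximum). $\mathbb{B}$ is the two-element Boolean semifield, so $\mathfrak{L}\neq\mathbb{B}$ means $\mathfrak{L}^*$ is non-trivial. $UT_n(\mathfrak{L}^* )$ is the semigroup (under matrix multiplication) of upper triangular $n\times n$ matrices over $\mathfrak{L}$ all of whose entries on and above the diagonal are non-zero. For a semigroup $T$: $a\,\widetilde{\mathcal{R}}\,b$ iff for all idempotents $e\in T$, $ea=a\Leftrightarrow eb=b$; $a\,\widetilde{\mathcal{L}}\,b$ iff for all idempotents $e\in T$, $ae=a\Leftrightarrow be=b$; $\widetilde{\mathcal{H}}=\widetilde{\mathcal{R}}\cap\widetilde{\mathcal{L}}$. *)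

(* Defs.v *)
From HB Require Import structures.
From mathcomp Require Import all_boot all_order all_algebra.

Set Implicit Arguments.
Unset Strict Implicit.
Unset Printing Implicit Defensive.

Import GRing.Theory.
Local Open Scope ring_scope.

(* The nonzero elements are required to be invertible; that they are closed
   under multiplication, hence form an abelian group, follows (see mulf_neq0). *)
HB.mixin Record isLinIdemSemifield (L : Type) of GRing.ComNzSemiRing L := {
  addLI : forall x : L, x + x = x;
  invLI : forall x : L, x != 0 -> exists y : L, x * y = 1;
  totalLI : total [rel a b : L | a + b == b]
}.

#[short(type="linIdemSemifieldType")]
HB.structure Definition LinIdemSemifield :=
  { L of GRing.ComNzSemiRing L & isLinIdemSemifield L }.

Section SemifieldTheory.
Variable L : linIdemSemifieldType.
Implicit Types x y : L.

Lemma mulf_neq0 x y : x != 0 -> y != 0 -> x * y != 0.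
Proof.
move=> /invLI[z xz] /eqP y0; apply/eqP => xy; apply: y0.
by rewrite -[y]mul1r -xz (mulrC x) -mulrA xy mulr0.
Qed.

Lemma addf_neq0 x y : x != 0 -> x + y != 0.
Proof.
move=> /eqP x0; apply/eqP => xy; apply: x0.
by rewrite -[x]addr0 -[in LHS]xy addrA addLI.
Qed.

End SemifieldTheory.

Section UpperTriangular.
Variables (L : linIdemSemifieldType) (n : nat).

Definition is_ut (A : 'M[L]_n) : bool :=
  [forall i : 'I_n, forall j : 'I_n,
     if (i <= j)%N then A i j != 0 else A i j == 0].

Record UT := MkUT { utmx :> 'M[L]_n; utmxP : is_ut utmx }.

HB.instance Definition _ := [isSub for utmx].
HB.instance Definition _ := [Choice of UT by <:].

Lemma is_utP (A : 'M[L]_n) :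
  reflect (forall i j : 'I_n, if (i <= j)%N then A i j != 0 else A i j == 0)
          (is_ut A).
Proof. exact: 'forall_forallP. Qed.

Lemma is_ut_mulmx (A B : 'M[L]_n) : is_ut A -> is_ut B -> is_ut (A *m B).
Proof.
move=> /is_utP hA /is_utP hB; apply/is_utP => i j; rewrite mxE.
case: ifPn => [le_ij|]; last first.
  rewrite -ltnNge => lt_ji; apply/eqP; apply: big1 => k _.
  have := hA i k; have := hB k j.
  case: leqP => [le_kj _|_ /eqP->]; last by rewrite mulr0.
  by rewrite leqNgt (leq_ltn_trans le_kj lt_ji) /= => /eqP->; rewrite mul0r.
rewrite (bigD1 i) //= addf_neq0 // mulf_neq0 //.
  by have := hA i i; rewrite leqnn.
by have := hB i j; rewrite le_ij.
Qed.

Definition ut_mul (A B : UT) : UT := MkUT (is_ut_mulmx (utmxP A) (utmxP B)).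

Fact ut_mulA : associative ut_mul.
Proof. by move=> A B C; apply: val_inj; rewrite /= mulmxA. Qed.

HB.instance Definition _ := isSemigroup.Build UT ut_mulA.

End UpperTriangular.

Arguments UT L n : clear implicits.

Section TildeRelations.
Variable T : semigroupType.
Local Open Scope group_scope.
Implicit Types a b e : T.

Definition idem e : Prop := e * e = e.

Definition Rtilde a b : Prop :=
  forall e, idem e -> (e * a = a <-> e * b = b).

Definition Ltilde a b : Prop :=
  forall e, idem e -> (a * e = a <-> b * e = b).

Definition Htilde a b : Prop := Rtilde a b /\ Ltilde a b.

Definition subsemigroup (S : T -> Prop) : Prop :=
  forall a b, S a -> S b -> S (a * b).

End TildeRelations.

(* Main.v *)
Require Import Defs.
From mathcomp Require Import all_boot all_algebra.

Set Implicit Arguments.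
Unset Strict Implicit.
Unset Printing Implicit Defensive.

Import GRing.Theory.
Local Open Scope ring_scope.

(** Write the order of [L] as [x + y = y] and think of [L*] additively, so that
    matrix multiplication is max-plus multiplication.  Idempotents of [UT L n]
    have unit diagonal, and if [E] is idempotent then an idempotent [F] fixes
    [E] on the left exactly when [F <= E] entrywise.  On the other hand [F]
    fixes a matrix [A] on the left exactly when
    [F i k <= min_(j >= k) (A i j - A k j)] for all [i <= k].  Hence [A] is in
    the class of [E] as soon as that minimum, and the dual one for the right
    action, equal [E i k]; this sufficient criterion is [Htilde_residual].

    That the class is not closed is shown by a 5 by 5 example with integer
    entries, the exponents of some [g > 1]:
<<
            0  0  0  2  2              0  0  0  2  2
               0  0  1  2                -1  0  0  2
       E =        0  0  0       A =          0  0  0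
                     0  0                      -1  0
                        0                          0
>>
    The criterion holds for [A].  In position (2,4), counting from 1, the minimum
    is [min (0 + 1, 2 - 0) = 1].  Squaring [A] doubles the two negative diagonal
    entries and changes nothing else: the (2,4) entry stays [0] because it is
    also reached through index 3, whose diagonal entry is [0].  The minimum for
    [A * A] at (2,4) is therefore [min (0 + 2, 2 - 0) = 2 > 1], so the idempotent
    [F] obtained from [E] by raising this entry from 1 to 2 fixes [A * A] but not
    [E].  Below, [A] is multiplied by [g], a scalar that changes no difference of
    entries, so that natural exponents suffice.

    For larger [n] the last index is repeated: with indices from 0, the entry at
    [(i, j)] is read at [(min i 4, min j 4)].  Paths [i <= k <= j] of the big
    matrix project to paths of the small one, and all of these lift back
    ([clamp_lift]), so products and minima are the same as for [n = 5]. *)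

(** * The order of a linearly ordered idempotent semifield *)

Section Order.
Variable L : linIdemSemifieldType.
Implicit Types x y z : L.

Lemma sum_le (I : finType) (F : I -> L) z :
  (forall i, F i + z = z) -> \sum_i F i + z = z.
Proof.
move=> le_F; elim/big_rec: _ => [|i s _ IH]; first by rewrite add0r.
by rewrite -addrA IH.
Qed.

Lemma le_sum (I : finType) (F : I -> L) i : F i + \sum_j F j = \sum_j F j.
Proof. by rewrite (bigD1 i) //= addrA addLI. Qed.

Lemma mulfI_semifield z x y : z != 0 -> x * z = y * z -> x = y.
Proof.
move=> /invLI[w zw] /(congr1 ( *%R^~ w)).
by rewrite -!mulrA zw !mulr1.
Qed.

Lemma le_mul2r z x y : z != 0 -> x * z + y * z = y * z -> x + y = y.
Proof. by move=> z0; rewrite -mulrDl => /(mulfI_semifield z0). Qed.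

Lemma exists_gt1 :
  (exists x : L, x != 0 /\ x != 1) ->
  exists g : L, [/\ g != 0, g != 1 & 1 + g = g].
Proof.
case=> x [x0 x1]; have /orP[/eqP x_le1|/eqP le1x] := totalLI x 1; last first.
  by exists x.
have [y xy] := invLI x x0; exists y; split.
- by apply: contraNneq (oner_neq0 L) => y0; rewrite -xy y0 mulr0.
- by apply: contraNneq x1 => y1; rewrite -xy y1 mulr1.
- by rewrite -{1}xy -{2}[y]mul1r -mulrDl x_le1 mul1r.
Qed.

End Order.

(** * Idempotents and the class of an idempotent *)

Section Idempotents.
Variables (L : linIdemSemifieldType) (n : nat).
Implicit Types (A E F : UT L n) (i j k : 'I_n).

Lemma UT_neq0 A i j : (i <= j)%N -> A i j != 0.
Proof. by move=> le_ij; have /is_utP/(_ i j) := utmxP A; rewrite le_ij. Qed.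

Lemma UT_eq0 A i j : (j < i)%N -> A i j = 0.
Proof.
by move=> lt_ji; have /is_utP/(_ i j) := utmxP A; rewrite leqNgt lt_ji => /eqP.
Qed.

Lemma idem_diag F i : idem F -> F i i = 1.
Proof.
move=> /(congr1 (fun A : UT L n => A i i)); rewrite /= mxE (bigD1 i) //=.
rewrite big1 ?addr0 => [FF|k neq_ki].
  by apply: (@mulfI_semifield _ (F i i)); rewrite ?mul1r ?UT_neq0.
by case: (ltngtP k i) => [/(UT_eq0 F)->|/(UT_eq0 F)->|/val_inj eq_ki];
  rewrite ?mul0r ?mulr0 // eq_ki eqxx in neq_ki *.
Qed.

Lemma idem_ge1 F : idem F -> 1%:M + utmx F = utmx F.
Proof.
move=> idF; apply/matrixP => i j; rewrite !mxE.
by case: eqP => [<-|_]; rewrite ?add0r // idem_diag // addLI.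
Qed.

(** [E <= F * E] because [1 <= F], and [F * E <= E * E = E] by monotony. *)
Lemma idem_mul_le_l E F : idem E -> idem F -> utmx F + utmx E = utmx E ->
  (F * E)%g = E.
Proof.
move=> idE idF FE; apply: val_inj => /=.
have EE : utmx E *m utmx E = utmx E := congr1 val idE.
have le1 : utmx F *m utmx E + utmx E = utmx E by rewrite -{2 3}EE -mulmxDl FE.
by rewrite -[RHS]le1 addrC -[X in X + _]mul1mx -mulmxDl idem_ge1.
Qed.

Lemma idem_mul_le_r E F : idem E -> idem F -> utmx F + utmx E = utmx E ->
  (E * F)%g = E.
Proof.
move=> idE idF FE; apply: val_inj => /=.
have EE : utmx E *m utmx E = utmx E := congr1 val idE.
have le1 : utmx E *m utmx F + utmx E = utmx E by rewrite -{2 3}EE -mulmxDr FE.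
by rewrite -[RHS]le1 addrC -[X in X + _]mulmx1 -mulmxDr idem_ge1.
Qed.

(** The two existence hypotheses say that [E i k] is at least, hence equal to,
    the minimum of the quotients [A i j / A k j] over [j >= k], and dually.  A
    fixing idempotent is bounded by each of these quotients, hence by [E]. *)
Lemma Htilde_residual E A :
    idem E -> (E * A)%g = A -> (A * E)%g = A ->
    (forall i k : 'I_n, (i <= k)%N ->
       exists2 j : 'I_n, (k <= j)%N & A i j = E i k * A k j) ->
    (forall k j : 'I_n, (k <= j)%N ->
       exists2 i : 'I_n, (i <= k)%N & A i j = A i k * E k j) ->
  Htilde E A.
Proof.
move=> idE EA AE resl resr; split=> F idF; split=> [FE|FA].
- by rewrite -EA mulgA FE.
- apply: idem_mul_le_l => //; apply/matrixP => i k; rewrite mxE.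
  have [le_ik|lt_ki] := leqP i k; last by rewrite !UT_eq0 // addr0.
  have [j le_kj Aij] := resl i k le_ik.
  apply: (@le_mul2r _ (A k j)); first exact: UT_neq0.
  have := congr1 (fun B : UT L n => B i j) FA; rewrite -Aij /= mxE => <-.
  exact: (le_sum (fun l => F i l * A l j)).
- by rewrite -AE -mulgA FE.
- apply: idem_mul_le_r => //; apply/matrixP => k j; rewrite mxE.
  have [le_kj|lt_jk] := leqP k j; last by rewrite !UT_eq0 // addr0.
  have [i le_ik Aij] := resr k j le_kj.
  apply: (@le_mul2r _ (A i k)); first exact: UT_neq0.
  have := congr1 (fun B : UT L n => B i j) FA.
  rewrite ![_ * A i k]mulrC -Aij /= mxE => <-.
  exact: (le_sum (fun l => A i l * F l j)).
Qed.

End Idempotents.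

(** * Matrices of powers, with the last index repeated *)

Definition clamp (i : nat) : nat := minn i 4.

(** Since [i <= j], the clamped path [clamp i <= k <= clamp j] lifts: [k < 4] is
    its own lift, and [k = 4] forces [clamp j = 4] and lifts to [j]. *)
Lemma clamp_lift i j k : (i <= j)%N -> (clamp i <= k <= clamp j)%N ->
  exists2 l, (i <= l <= j)%N & clamp l = k.
Proof.
rewrite /clamp => le_ij /andP[ik kj].
have [lt_k4|le_4k] := ltnP k 4.
  exists k; last by apply/minn_idPl/ltnW.
  move: ik kj; rewrite leq_min geq_min leqNgt => ik /andP[-> _].
  by rewrite andbT; case/orP: ik => // /(leq_trans lt_k4); rewrite ltnn.
exists j; first by rewrite le_ij leqnn.
by apply/eqP; rewrite eqn_leq kj andbT (leq_trans _ le_4k) // geq_minr.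
Qed.

Lemma clamp_mono i j : (i <= j)%N -> (clamp i <= clamp j)%N.
Proof. by move=> le_ij; rewrite leq_min !geq_min le_ij leqnn orbT. Qed.

Definition entry (t : seq (seq nat)) i j : nat := nth 0%N (nth [::] t i) j.

Definition all_upper (P : nat -> nat -> bool) : bool :=
  all (fun j => all (P^~ j) (iota 0 j.+1)) (iota 0 5).

Lemma all_upperP P i j : all_upper P -> (i <= j)%N -> P (clamp i) (clamp j).
Proof.
move=> /allP /(_ (clamp j)) Pj le_ij.
have /Pj/allP : clamp j \in iota 0 5 by rewrite mem_iota /= ltnS geq_minr.
by apply; rewrite mem_iota /= ltnS clamp_mono.
Qed.

Definition path_bounded s t u i j : bool :=
  all (fun k => entry s i k + entry t k j <= entry u i j)%N (iota i (j.+1 - i)).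

Definition path_attained s t u i j : bool :=
  has (fun k => entry s i k + entry t k j == entry u i j)%N (iota i (j.+1 - i)).

(** [u] is the max-plus product of [s] and [t] on the upper triangle, in a form
    that is decided by computation. *)
Definition maxplus s t u : bool :=
  all_upper (fun i j => path_bounded s t u i j && path_attained s t u i j).

(** When [e] fixes [a] on the left, [e i k] is a lower bound of the differences
    [a i j - a k j] over [j >= k]; this asks that one of them attain it. *)
Definition left_residual a e : bool :=
  all_upper (fun i k =>
    has (fun j => entry a i j == entry e i k + entry a k j)%N (iota k (5 - k))).

Definition right_residual a e : bool :=
  all_upper (fun k j =>
    has (fun i => entry a i j == entry a i k + entry e k j)%N (iota 0 k.+1)).

Section PowerMatrices.
Variables (L : linIdemSemifieldType) (g : L).
Hypotheses (g0 : g != 0) (le1g : 1 + g = g).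

Lemma gX_neq0 k : g ^+ k != 0.
Proof. by elim: k => [|k IH]; rewrite ?oner_neq0 // exprS Defs.mulf_neq0. Qed.

Lemma gX_le a b : (a <= b)%N -> g ^+ a + g ^+ b = g ^+ b.
Proof.
move=> /subnKC <-; elim: (b - a)%N => [|k IH]; first by rewrite addn0 addLI.
have le_S c : g ^+ c + g ^+ c.+1 = g ^+ c.+1.
  by rewrite exprS -{1}[g ^+ c]mul1r -mulrDl le1g.
by rewrite addnS -(le_S (a + k)%N) addrA IH.
Qed.

Variable n : nat.
Hypothesis n_ge5 : (5 <= n)%N.

Definition powmx (t : seq (seq nat)) : 'M[L]_n :=
  \matrix_(i, j) if (i <= j)%N then g ^+ entry t (clamp i) (clamp j) else 0.

Lemma powmx_ut t : is_ut (powmx t).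
Proof. by apply/is_utP => i j; rewrite mxE; case: leqP; rewrite // gX_neq0. Qed.

Definition powUT t : UT L n := MkUT (powmx_ut t).

Lemma powUT_upper t (i j : 'I_n) :
  (i <= j)%N -> powUT t i j = g ^+ entry t (clamp i) (clamp j).
Proof. by rewrite mxE => ->. Qed.

Lemma powUT_mul s t u : maxplus s t u -> (powUT s * powUT t)%g = powUT u.
Proof.
move=> stu; apply: val_inj; apply/matrixP => i j /=.
have [le_ij|lt_ji] := leqP i j; last first.
  by rewrite [LHS](UT_eq0 (powUT s * powUT t)%g) // (UT_eq0 (powUT u)).
have /andP[/allP bnd /hasP[k]] := all_upperP stu le_ij.
have ik_iota l : (l \in iota (clamp i) ((clamp j).+1 - clamp i)) =
    (clamp i <= l <= clamp j)%N.
  by rewrite mem_iota subnKC // leqW // clamp_mono.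
rewrite ik_iota => /(clamp_lift le_ij)[l /andP[il lj] <-] /eqP attained.
have ln : (l < n)%N := leq_ltn_trans lj (ltn_ord j).
have le_prod : powmx u i j + (powmx s *m powmx t) i j = (powmx s *m powmx t) i j.
  have -> : powmx u i j = powmx s i (Ordinal ln) * powmx t (Ordinal ln) j.
    by rewrite !mxE /= le_ij il lj -exprD attained.
  by rewrite [(_ *m _) i j]mxE (le_sum (fun l => powmx s i l * powmx t l j)).
rewrite -le_prod addrC mxE; apply: sum_le => m; rewrite !mxE le_ij.
have [im|_] := leqP i m; last by rewrite mul0r add0r.
have [mj|_] := leqP m j; last by rewrite mulr0 add0r.
by rewrite -exprD gX_le // bnd // ik_iota !clamp_mono.
Qed.

Lemma powUT_Htilde e a :
    maxplus e e e -> maxplus e a a -> maxplus a e a ->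
    left_residual a e -> right_residual a e ->
  Htilde (powUT e) (powUT a).
Proof.
move=> ee ea ae resl resr; apply: Htilde_residual; try exact: powUT_mul.
- move=> i k le_ik; have /hasP[j] := all_upperP resl le_ik.
  have k_le5 : (clamp k <= 5)%N by rewrite leqW // geq_minr.
  rewrite mem_iota subnKC // ltnS => kj /eqP aij.
  have n_pred : (n.-1.+1 = n)%N by rewrite prednK // (leq_trans _ n_ge5).
  have k_last : (k <= n.-1)%N by rewrite -ltnS n_pred.
  have last4 : clamp n.-1 = 4 by apply/minn_idPr; rewrite -ltnS n_pred.
  have [|l /andP[kl]] := @clamp_lift k n.-1 j k_last; first by rewrite last4.
  rewrite -ltnS n_pred => ln lj; exists (Ordinal ln) => //.
  by rewrite !powUT_upper ?(leq_trans le_ik) // -exprD /= lj aij.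
- move=> k j le_kj; have /hasP[i] := all_upperP resr le_kj.
  rewrite mem_iota add0n ltnS /= => ik /eqP aij.
  have [|l /andP[_ lk] li] := @clamp_lift 0 k i (leq0n k); first by rewrite ik.
  have ln : (l < n)%N := leq_ltn_trans lk (ltn_ord k).
  exists (Ordinal ln) => //.
  by rewrite !powUT_upper ?(leq_trans lk) // -exprD /= li aij.
Qed.

End PowerMatrices.

(** * The counterexample *)

(** Below the diagonal the rows are padded with zeros that are never read. *)
Definition expE := [:: [:: 0; 0; 0; 2; 2];
                       [:: 0; 0; 0; 1; 2];
                       [:: 0; 0; 0; 0; 0];
                       [:: 0; 0; 0; 0; 0];
                       [:: 0; 0; 0; 0; 0]]%N.

Definition expF := [:: [:: 0; 0; 0; 2; 2];
                       [:: 0; 0; 0; 2; 2];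
                       [:: 0; 0; 0; 0; 0];
                       [:: 0; 0; 0; 0; 0];
                       [:: 0; 0; 0; 0; 0]]%N.

Definition expA := [:: [:: 1; 1; 1; 3; 3];
                       [:: 0; 0; 1; 1; 3];
                       [:: 0; 0; 1; 1; 1];
                       [:: 0; 0; 0; 0; 1];
                       [:: 0; 0; 0; 0; 1]]%N.

Definition expAA := [:: [:: 2; 2; 2; 4; 4];
                        [:: 0; 0; 2; 2; 4];
                        [:: 0; 0; 2; 2; 2];
                        [:: 0; 0; 0; 0; 2];
                        [:: 0; 0; 0; 0; 2]]%N.

Theorem proposition7p16 (L : linIdemSemifieldType)
    (hL : exists x : L, x != 0 /\ x != 1) (n : nat) (hn : (5 <= n)%N) :
  exists E : UT L n, idem E /\ ~ subsemigroup (Htilde E).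
Proof.
have [g [g0 g1 le1g]] := exists_gt1 hL.
have mulP := @powUT_mul L g g0 le1g n.
exists (powUT g0 n expE); split; first exact: mulP.
have HA : Htilde (powUT g0 n expE) (powUT g0 n expA) by apply: powUT_Htilde.
have idF : idem (powUT g0 n expF) by exact: mulP.
move=> /(_ _ _ HA HA)[/(_ _ idF)[_ FE] _].
have /FE : (powUT g0 n expF * (powUT g0 n expA * powUT g0 n expA) =
            powUT g0 n expA * powUT g0 n expA)%g.
  by rewrite (mulP _ _ expAA) // (mulP _ _ expAA).
rewrite (mulP _ _ expF) // => FeqE.
have n1 : (1 < n)%N := leq_trans (isT : 1 < 5)%N hn.
have n3 : (3 < n)%N := leq_trans (isT : 3 < 5)%N hn.
have := congr1 (fun B : UT L n => B (Ordinal n1) (Ordinal n3)) FeqE.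
rewrite !powUT_upper //= exprS -[RHS]mul1r.
move=> /(mulfI_semifield (gX_neq0 g0 1)).
by apply/eqP.
Qed.
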